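(* Let $M'$ be the numeric $(|S|-1)\times|S|$ interpolation matrix of a (hypersurface) object with support $S$, assumed to be of full rank, let $S(\rho)$ be the row vector of polynomials in $\rho$ obtained by substituting a ray $x_i=r_i(\rho)$, $i=1,\dots,n$, into the monomials with exponents in $S$, and let $M(\rho)$ be the $|S|\times|S|$ matrix with $M(\rho)^T=[\,(M')^T\,|\,S(\rho)^T\,]$. Consider a PLU-decomposition $(M')^T=PLU$ (which does not depend on the particular ray). Then $\det M(\rho)$ equals, up to a nonzero scalar factor, the inner product of the last row of $L^{-1}P^{T}$ with the column vector $S(\rho)^T$. Analogously, if $(M')^T=QR$ is a QR-decomposition, then $\det M(\rho)$ equals, up to a nonzero scalar factor, the inner product of the last row of $Q^{T}$ with the column vector $S(\rho)^T$.
   Context: $S=\{a_1,\dots,a_{|S|}\}$ is a finite set of exponent vectors of monomials $x^{a_i}=x_1^{a_{i1}}\cdots x_n^{a_{in}}$ (a superset of the monomials of the implicit polynomial of the hypersurface). The matrix $M'$ is the numeric $(|S|-1)\times|S|$ matrix whose $k$-th row is the vector of values of these monomials at the $k$-th of $|S|-1$ sample points on the hypersurface. A ray is given by $x_i=r_i(\rho)$, $i=1,\dots,n$, $\rho>0$, with $r_i\in\mathbb{R}[\rho]$ linear polynomials. $M(\rho)$ is $M'$ with the row $S(\rho)$ appended as last row. In the PLU-decomposition, $P$ is an $|S|\times|S|$ permutation matrix, $L$ is an $|S|\times|S|$ lower-triangular matrix with unit diagonal, and $U$ is an $|S|\times(|S|-1)$ upper-triangular numeric matrix whose last row is zero. In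 the QR-decomposition, $Q$ is an $|S|\times|S|$ orthogonal matrix and $R$ is an $|S|\times(|S|-1)$ upper-triangular matrix whose last row is zero. $[\,\cdot\,|\,\cdot\,]$ denotes concatenation of matrices. *)

(* Defs.v *)
From mathcomp Require Import all_boot all_order all_algebra.
From mathcomp Require Import reals mpoly.

Set Implicit Arguments.
Unset Strict Implicit.
Unset Printing Implicit Defensive.

Import GRing.Theory.
Local Open Scope ring_scope.

(** Throughout, [|S| = m + 1].  The size is written [m + 1]
    rather than [m.+1] so that appending one row to an [m]-row matrix with
    [col_mx] yields a square matrix without a cast. *)

Definition last_ord (m : nat) : 'I_(m + 1) := rshift m ord0.

(** Row vector of the values at [x] of the monomials with exponents in [S];
    [mmap1 x a] is [\prod_i x i ^+ a i].  [A] is the field of scalars for a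
    sample point, and the ring [{poly R}] for a ray. *)
Definition monomial_row (A : comNzRingType) (n s : nat)
    (S : s.-tuple 'X_{1..n}) (x : 'I_n -> A) : 'rV[A]_s :=
  \row_j mmap1 x (tnth S j).

Definition interpolation_matrix (R : comNzRingType) (n m s : nat)
    (S : s.-tuple 'X_{1..n}) (pts : 'I_m -> 'I_n -> R) : 'M[R]_(m, s) :=
  \matrix_(k < m) monomial_row S (pts k).

(** The indeterminate of [{poly R}] is the ray parameter rho.  By [tr_col_mx] the
    transpose is [row_mx (map_mx polyC M')^T (monomial_row S r)^T]. *)
Definition ray_matrix (R : comNzRingType) (n m : nat)
    (S : (m + 1).-tuple 'X_{1..n}) (M' : 'M[R]_(m, m + 1))
    (r : 'I_n -> {poly R}) : 'M[{poly R}]_(m + 1) :=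
  col_mx (map_mx polyC M') (monomial_row S r).

(** The entries may be constants: a ray can be parallel to a coordinate
    hyperplane. *)
Definition linear_ray (R : nzRingType) (n : nat) (r : 'I_n -> {poly R}) :=
  forall i, (size (r i) <= 2)%N.

Definition unit_lower_triangular (R : nzRingType) (s : nat) (L : 'M[R]_s) :=
  is_trig_mx L /\ forall i, L i i = 1.

(** Vanishing of the last row already follows from the triangular shape of an
    [(m + 1) * m] matrix. *)
Definition upper_triangular_last0 (R : nzRingType) (m : nat)
    (U : 'M[R]_(m + 1, m)) :=
  (forall (i : 'I_(m + 1)) (j : 'I_m), (j < i)%N -> U i j = 0)
  /\ row (last_ord m) U = 0.

Definition is_PLU (R : nzRingType) (m : nat) (A : 'M[R]_(m + 1, m))
    (P L : 'M[R]_(m + 1)) (U : 'M[R]_(m + 1, m)) :=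
  [/\ is_perm_mx P, unit_lower_triangular L, upper_triangular_last0 U
    & A = P *m L *m U].

Definition orthogonal_mx (R : nzRingType) (s : nat) (Q : 'M[R]_s) :=
  Q^T *m Q = 1%:M /\ Q *m Q^T = 1%:M.

Definition is_QR (R : nzRingType) (m : nat) (A : 'M[R]_(m + 1, m))
    (Q : 'M[R]_(m + 1)) (T : 'M[R]_(m + 1, m)) :=
  [/\ orthogonal_mx Q, upper_triangular_last0 T & A = Q *m T].

Definition last_row_dot (R : comNzRingType) (m : nat) (A : 'M[R]_(m + 1))
    (v : 'rV[{poly R}]_(m + 1)) : {poly R} :=
  (map_mx polyC (row (last_ord m) A) *m v^T) 0 0.

(* Main.v *)
Require Import Defs.
From mathcomp Require Import all_boot all_order all_algebra.
From mathcomp Require Import fingroup perm.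
From mathcomp Require Import reals mpoly.

Set Implicit Arguments.
Unset Strict Implicit.
Unset Printing Implicit Defensive.

Import GRing.Theory.
Local Open Scope ring_scope.

(** Let [v := monomial_row S r].  Multiplying on the left by an invertible [B] with
    [B *m M'^T = U], where the last row of [U] vanishes, turns
    [(ray_matrix S M' r)^T = [M'^T | v^T]] into a
    block upper triangular matrix: the last row of its first [m] columns is zero,
    so its determinant is that of the upper [m * m] block of [U] times the last
    entry of [B *m v^T].  Up to the constant [\det B] this is the determinant
    sought, and the upper block of [U] is invertible because [M'] has rank [m].
    This is [det_col_mx_elim].

    Both factorizations provide such a [B]: [invmx L *m P^T] for [P L U], since
    the transpose of a permutation matrix is its inverse, and [Q^T] for [Q R]. *)

Lemma last0_col_mx (R : nzRingType) (m : nat) (U : 'M[R]_(m + 1, m)) :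
  row (last_ord m) U = 0 -> U = col_mx (usubmx U) 0.
Proof.
move=> U0; rewrite -[LHS]vsubmxK; congr col_mx.
apply/matrixP=> i j; rewrite ord1 !mxE.
by move/rowP/(_ j): U0; rewrite !mxE.
Qed.

(** Deleting the zero last row preserves the rank, which is then maximal. *)
Lemma unit_usubmx_last0 (F : fieldType) (m : nat) (U : 'M[F]_(m + 1, m)) :
  row (last_ord m) U = 0 -> \rank U = m -> usubmx U \in unitmx.
Proof.
move=> /last0_col_mx defU rkU.
by rewrite -row_full_unit /row_full -(rank_col_mx0 1) -defU rkU.
Qed.

Lemma dsubmx_last_row_dot (R : comNzRingType) (m : nat) (B : 'M[R]_(m + 1))
    (v : 'rV[{poly R}]_(m + 1)) :
  dsubmx (map_mx polyC B *m v^T) 0 0 = last_row_dot B v.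
Proof.
by rewrite /last_row_dot map_row -row_mul !mxE.
Qed.

(** The elimination step shared by the two factorizations.  The constant is
    [\det U1 / \det B], with [U1] the upper square block of [B *m M'^T]; it is
    thus the same for all appended rows [v], in particular for all rays. *)
Lemma det_col_mx_elim (F : fieldType) (m : nat) (M' : 'M[F]_(m, m + 1))
    (B : 'M[F]_(m + 1)) (v : 'rV[{poly F}]_(m + 1)) :
    \rank M' = m -> B \in unitmx -> row (last_ord m) (B *m M'^T) = 0 ->
  exists2 c : F, c != 0 &
    \det (col_mx (map_mx polyC M') v) = c *: last_row_dot B v.
Proof.
move=> rkM uB U0.
have rkU : \rank (B *m M'^T) = m.
  by rewrite eqmxMfull ?row_full_unit // mxrank_tr.
have uU := unit_usubmx_last0 U0 rkU.
move/last0_col_mx: U0 => defU; move: defU uU; set U1 := usubmx _ => defU uU.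
have dB0 : \det B != 0 by rewrite -unitfE -unitmxE.
exists (\det U1 / \det B).
  by rewrite mulf_neq0 ?invr_eq0 // -unitfE -unitmxE.
have detE : (\det B)%:P * \det (col_mx (map_mx polyC M') v)
            = (\det U1)%:P * last_row_dot B v.
  (* [B *m [M'^T | v^T] = [B *m M'^T | B *m v^T]] is block upper triangular. *)
  rewrite -[\det (col_mx _ _)]det_tr tr_col_mx -det_map_mx -det_mulmx.
  rewrite mul_mx_row matrix.map_trmx -map_mxM defU map_col_mx map_mx0.
  rewrite -[X in row_mx _ X]vsubmxK -block_mxEh det_ublock det_map_mx det_mx11.
  by rewrite dsubmx_last_row_dot.
rewrite mulrC -scalerA -[\det U1 *: _]mul_polyC -detE mul_polyC.
by rewrite scalerA mulVf ?scale1r.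
Qed.

Theorem lemma2 (R : realType) (n m : nat) (S : (m + 1).-tuple 'X_{1..n})
    (p : {mpoly R[n]}) (pts : 'I_m -> 'I_n -> R) (M' : 'M[R]_(m, m + 1))
    (S_uniq : uniq S)
    (p_neq0 : p != 0)
    (supp_p : {subset msupp p <= S})
    (on_hypersurface : forall k, p.@[pts k] = 0)
    (M'_def : M' = interpolation_matrix S pts)
    (M'_full_rank : \rank M' = m) :
  (forall (P L : 'M[R]_(m + 1)) (U : 'M[R]_(m + 1, m)),
     is_PLU M'^T P L U ->
     forall r : 'I_n -> {poly R}, linear_ray r ->
     exists2 c : R, c != 0 &
       \det (ray_matrix S M' r)
         = c *: last_row_dot (invmx L *m P^T) (monomial_row S r))
  /\
  (forall (Q : 'M[R]_(m + 1)) (T : 'M[R]_(m + 1, m)),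
     is_QR M'^T Q T ->
     forall r : 'I_n -> {poly R}, linear_ray r ->
     exists2 c : R, c != 0 &
       \det (ray_matrix S M' r)
         = c *: last_row_dot Q^T (monomial_row S r)).
Proof.
split=> [P L U [permP [trigL L1] [_ U0] defA] | Q T [[QTQ _] [_ T0] defA]] r _.
  have uL : L \in unitmx.
    by rewrite unitmxE det_trig // big1 ?unitr1 // => i _; apply: L1.
  have /is_perm_mxP[s defP] := permP.
  have PTP : P^T *m P = 1%:M.
    by rewrite defP tr_perm_mx -perm_mxM mulVg perm_mx1.
  apply: det_col_mx_elim => //.
    by rewrite unitmx_mul unitmx_inv uL; case/mulmx1_unit: PTP.
  by rewrite defA -!mulmxA [P^T *m _]mulmxA PTP mul1mx mulKmx.
apply: det_col_mx_elim => //; first by case/mulmx1_unit: QTQ.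
by rewrite defA mulmxA QTQ mul1mx.
Qed.
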